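(* Let $\hat x\in X$ be a feasible interdiction strategy and let $S(\hat x)=\{i\in N:\hat x_i=1\}$. Let $\tilde d\in\mathbb{R}^n$ be a vector satisfying the following conditions: 1. $\tilde d_i\le d_i$ for all $i\in N$; 2. $\sum_{i\in P}\tilde d_i\ge \Phi_I(\hat x)-\Phi_I(x')$ for each $P\subseteq S(\hat x)$ such that there exists $w\in W$ with $w_i=1$ for all $i\in P$, where $x'$ is the interdiction strategy with $x'_i=0$ for all $i\in P$ and $x'_i=\hat x_i$ otherwise. Then the inequality $$\theta\ge \Phi_I(\hat x)-\sum_{i\in N}\tilde d_i\hat x_i w_i$$ is valid for the fortification game and dominates the fortification cut $\theta\ge \Phi_I(\hat x)-\sum_{i\in N} d_i\hat x_i w_i$ for the interdiction strategy $\hat x$.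
   Context: Let $N$ be a finite set of assets, $n=|N|$. For each $i\in N$ let $f_i\ge 0$ be a fortification cost, $g_i\ge 0$ an interdiction cost, and $d_i\ge 0$ a depreciation; let $B_F\ge 0$ and $B_I\ge 0$ be the fortification and interdiction budgets. Let $c\in\mathbb{R}^n$ and let $Y\subseteq\{0,1\}^n$ be nonempty (the feasible set of the recourse problem). Define - $W=\{w\in\{0,1\}^n:\sum_{i\in N} f_i w_i\le B_F\}$ (feasible fortification strategies), - $X=\{x\in\{0,1\}^n:\sum_{i\in N} g_i x_i\le B_I\}$ (interdiction strategies), - $X(w)=\{x\in X: x_i\le 1-w_i\ \forall i\in N\}$ for $w\in W$, - $\Phi_I(x)=\min_{y\in Y}\{c^Ty+\sum_{i\in N} d_i x_i y_i\}$ for $x\in X$, - $\Phi_F(w)=\max_{x\in X(w)}\Phi_I(x)$ for $w\in W$. The fortification game is $z^*=\min_{w\in W}\Phi_F(w)$, equivalently $\min\{\theta: w\in W,\ \theta\in\mathbb{R},\ \theta\ge\Phi_F(w)\}$. An inequality in $(w,\theta)$ is valid for the fortification game if it is satisfied by every $(w,\theta)$ with $w\in W$ and $\theta\ge\Phi_F(w)$. An inequality $\theta\ge a(w)$ dominates an inequality $\theta\ge b(w)$ if $a(w)\ge b(w)$ for all $w\in[0,1]^n$. *)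

(* Defs.v *)
From HB Require Import structures.
From mathcomp Require Import all_boot all_order all_algebra.

Set Implicit Arguments.
Unset Strict Implicit.
Unset Printing Implicit Defensive.

Import Order.TTheory GRing.Theory Num.Theory.
Local Open Scope ring_scope.

(* Vectors of {0,1}^N are boolean functions; they embed in R^N through
   [realvec]. *)
Notation binvec N := {ffun N -> bool}.

Definition realvec (R : realFieldType) (N : finType) (x : binvec N) : N -> R :=
  fun i => (x i)%:R.

Record fortification_game (R : realFieldType) (N : finType) :=
  FortificationGame {
    fort_cost : N -> R;
    interd_cost : N -> R;
    depreciation : N -> R;
    fort_budget : R;
    interd_budget : R;
    recourse_cost : N -> R;
    recourse_set : {set binvec N};
    fort_cost_ge0 : forall i, 0 <= fort_cost i;
    interd_cost_ge0 : forall i, 0 <= interd_cost i;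
    depreciation_ge0 : forall i, 0 <= depreciation i;
    fort_budget_ge0 : 0 <= fort_budget;
    interd_budget_ge0 : 0 <= interd_budget;
    recourse_set_nonempty : exists y, y \in recourse_set
  }.

Section Game.
Variables (R : realFieldType) (N : finType) (G : fortification_game R N).

Definition W : {set binvec N} :=
  [set w : binvec N |
    \sum_i fort_cost G i * realvec R w i <= fort_budget G].

Definition X : {set binvec N} :=
  [set x : binvec N |
    \sum_i interd_cost G i * realvec R x i <= interd_budget G].

Definition Xof (w : binvec N) : {set binvec N} :=
  [set x in X | [forall i, realvec R x i <= 1 - realvec R w i]].

Definition recourse_value (x y : binvec N) : R :=
  \sum_i recourse_cost G i * realvec R y i
  + \sum_i depreciation G i * realvec R x i * realvec R y i.

(* The element of [recourse_set G] given by [xchoose] only witnesses that the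
   minimum is over a nonempty set: see [Phi_I_min]. *)
Definition Phi_I (x : binvec N) : R :=
  recourse_value x
    [arg min_(y < xchoose (recourse_set_nonempty G) in recourse_set G)
       recourse_value x y]%O.

(* Likewise the null strategy, which belongs to every [Xof w]:
   see [Phi_F_max]. *)
Definition Phi_F (w : binvec N) : R :=
  Phi_I [arg max_(x > [ffun=> false] in Xof w) Phi_I x]%O.

Lemma Phi_I_min (x : binvec N) :
  (exists2 y, y \in recourse_set G & Phi_I x = recourse_value x y) /\
  (forall y, y \in recourse_set G -> Phi_I x <= recourse_value x y).
Proof.
rewrite /Phi_I; case: arg_minP => [|y Yy miny]; first exact: xchooseP.
by split; first exists y.
Qed.

Lemma Xof0 (w : binvec N) : [ffun=> false] \in Xof w.
Proof.
rewrite !inE; apply/andP; split.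
  rewrite big1 ?interd_budget_ge0 // => i _.
  by rewrite /realvec ffunE mulr0.
apply/forallP => i; rewrite /realvec ffunE.
by case: (w i); rewrite ?subrr ?subr0 ?ler01.
Qed.

Lemma Phi_F_max (w : binvec N) :
  (exists2 x, x \in Xof w & Phi_F w = Phi_I x) /\
  (forall x, x \in Xof w -> Phi_I x <= Phi_F w).
Proof.
rewrite /Phi_F; case: arg_maxP => [|x Xx maxx]; first exact: Xof0.
by split; first exists x.
Qed.

Definition valid_inequality (ineq : (N -> R) -> R -> Prop) : Prop :=
  forall (w : binvec N) (theta : R),
    w \in W -> Phi_F w <= theta -> ineq (realvec R w) theta.

End Game.

(* Here a and b stand for the inequalities theta >= a(w) and theta >= b(w). *)
Definition dominates (R : realFieldType) (N : finType) (a b : (N -> R) -> R) :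
    Prop :=
  forall w : N -> R, (forall i, 0 <= w i <= 1) -> b w <= a w.

Definition interdicted (N : finType) (x : binvec N) : {set N} :=
  [set i | x i].

Definition drop_assets (N : finType) (x : binvec N) (P : {set N}) : binvec N :=
  [ffun i => if i \in P then false else x i].

(* Main.v *)
(* Given w in W, apply the second condition to the set P of assets that are
   both interdicted by xhat and fortified by w: dropping P from xhat yields a
   strategy in X(w), whose value bounds Phi_F(w) from below. *)

Require Import Defs.
From mathcomp Require Import all_boot all_order all_algebra.

Import Order.TTheory GRing.Theory Num.Theory.
Local Open Scope ring_scope.

(** Turning entries off cannot raise the interdiction cost, since costs are nonnegative; any entry
    still on has [w i] false, as required by [Xof G w]. *)
Lemma drop_assets_Xof (R : realFieldType) (N : finType)
  (G : fortification_game R N) (x w : binvec N) :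
  x \in X G -> drop_assets x [set i | x i && w i] \in Xof G w.
Proof.
rewrite !inE => Xx; apply/andP; split.
  apply: le_trans Xx; apply: ler_sum => i _.
  rewrite ler_wpM2l ?interd_cost_ge0 // /realvec ffunE inE ler_nat.
  by case: (x i); case: (w i).
apply/forallP => i; rewrite /realvec ffunE inE.
by case: (x i); case: (w i); rewrite /= ?subrr ?subr0 ?ler01.
Qed.

Theorem theorem2 (R : realFieldType) (N : finType)
  (G : fortification_game R N) (xhat : binvec N) (hxhat : xhat \in X G)
  (dtilde : N -> R)
  (hle : forall i, dtilde i <= depreciation G i)
  (hsum : forall P : {set N}, P \subset interdicted xhat ->
     (exists2 w : binvec N, w \in W G & forall i, i \in P -> w i = true) ->
     \sum_(i in P) dtilde i >= Phi_I G xhat - Phi_I G (drop_assets xhat P)) :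
  valid_inequality G (fun w theta =>
    theta >= Phi_I G xhat - \sum_i dtilde i * realvec R xhat i * w i) /\
  dominates
    (fun w => Phi_I G xhat - \sum_i dtilde i * realvec R xhat i * w i)
    (fun w => Phi_I G xhat - \sum_i depreciation G i * realvec R xhat i * w i).
Proof.
split.
  move=> w theta Ww Phi_le; pose P := [set i | xhat i && w i].
  have PS : P \subset interdicted xhat.
    by apply/subsetP => i; rewrite !inE => /andP[].
  have Pw : exists2 w', w' \in W G & forall i, i \in P -> w' i = true.
    by exists w => // i; rewrite inE => /andP[].
  (* At binary [w], the product of the entries of [xhat] and [w] is the indicator of [P]. *)
  have -> : \sum_i dtilde i * realvec R xhat i * realvec R w i
            = \sum_(i in P) dtilde i.
    rewrite [RHS]big_mkcond /=; apply: eq_bigr => i _; rewrite inE /realvec.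
    by case: (xhat i); case: (w i); rewrite ?mulr0 ?mul0r ?mulr1.
  (* Isolating the sum over [P] gives the shape of [hsum]; what remains is that [drop_assets xhat P]
     competes in the maximum [Phi_F G w]. *)
  apply: le_trans Phi_le; rewrite lerBlDr -lerBlDl.
  apply: le_trans (hsum P PS Pw); rewrite lerD2l lerN2.
  exact: (Phi_F_max G w).2 _ (drop_assets_Xof _ _ _ _ _ hxhat).
(* Dominance holds term by term: [hle] is scaled by the nonnegative entries of [xhat] and [w]. *)
move=> w w01; rewrite lerD2l lerN2; apply: ler_sum => i _.
have /andP[w0 _] := w01 i.
by rewrite !ler_wpM2r ?hle // /realvec ler0n.
Qed.
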